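(* Let $G$ be a ribbon graph and $v$ a vertex of $G$. (1) Let $e_1, e_2$ be edges incident to $v$ and let $\beta_1 = \beta_{(v,e_1)}$, $\beta_2 = \beta_{(v,e_2)}$ be the corresponding Bernardi bijections $S(G) \to B(G)$. Then there exists $\gamma_0 \in \operatorname{Pic}^0(G)$ such that $\beta_2(T) = \gamma_0 \cdot \beta_1(T)$ for all $T \in S(G)$. (2) The action $\operatorname{Pic}^0(G) \times S(G) \to S(G)$ defined by $\gamma \cdot T := \beta_{(v,e)}^{-1}\left(\gamma \cdot \beta_{(v,e)}(T)\right)$, for an edge $e$ incident to $v$, depends only on $v$ and not on the choice of $e$.
   Context: A graph means a finite connected multigraph without loop edges; a ribbon graph is a graph with a cyclic ordering of the edges around each vertex. $S(G)$ is the set of spanning trees. Divisors are formal integer combinations of vertices; $\operatorname{Div}^d(G)$ those of degree $d$. For $f : V(G) \to \mathbb{Z}$, $\Delta f = \sum_{u} \big(\sum_{\text{edges } uw} (f(u)-f(w))\big)(u)$; principal divisors are those of the form $\Delta f$; $D \sim D'$ if $D - D'$ is principal. $\operatorname{Pic}^d(G)$ is the set of linear equivalence classes of degree-$d$ divisors; $\operatorname{Pic}^0(G)$ is a group acting on $\operatorname{Pic}^d(G)$ by addition. The genus is $g = |E(G)|-|V(G)|+1$. For a spanning tree $T$ with non-tree edges $e_1,\dots,e_g$, a $T$-break divisor is $\sum_i (v_i)$ with $v_i$ an endpoint of $e_i$; a break divisor is a $T$-break divisor for some $T$; $B(G)$ is the set of break divisors. Every class in $\operatorname{Pic}^g(G)$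 contains exactly one break divisor, so $\operatorname{Pic}^0(G)$ acts simply transitively on $B(G)$ by $\gamma \cdot D :=$ the unique break divisor linearly equivalent to $D + \gamma$. Bernardi map: for a vertex $v$, an edge $e$ incident to $v$, and a spanning tree $T$, the tour starts at $v$ and examines edges at $v$ in cyclic order starting with $e$; at a current vertex $u$, an examined edge $f \notin T$ is ''cut through'' from $u$ and the next edge at $u$ is examined, while an examined edge $f \in T$ is walked along to its other endpoint $u'$, after which the edges at $u'$ are examined in cyclic order starting with the edge after $f$. The tour ends when each tree edge has been traversed in both directions. For $f \notin T$, $\eta_{(v,e)}(f)$ is the endpoint from which $f$ is first cut through, and $\beta_{(v,e)}(T) = \sum_{f \notin T} (\eta_{(v,e)}(f)) \in B(G)$. The map $\beta_{(v,e)} : S(G) \to B(G)$ is a bijection. *)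

(* Defs.v *)
From HB Require Import structures.
From mathcomp Require Import all_boot all_order all_algebra.
Set Implicit Arguments. Unset Strict Implicit. Unset Printing Implicit Defensive.
Import Order.TTheory GRing.Theory Num.Theory.

(* A graph: finite vertex type V, finite edge type E,
   each edge f has two endpoints [ends f] (multigraph, parallel edges allowed).
   A ribbon structure: [rot u] lists the edges at u in their cyclic order
   (successor of f at u is [next (rot u) f], cyclically). *)

Section Ribbon.
Variables (V E : finType) (ends : E -> V * V).

Definition inc (u : V) (f : E) : bool := ((ends f).1 == u) || ((ends f).2 == u).
Definition other (u : V) (f : E) : V :=
  if (ends f).1 == u then (ends f).2 else (ends f).1.

Definition adjS (S : {set E}) : rel V :=
  fun x y => [exists f in S, inc x f && inc y f && (x != y)].

Definition connected_via (S : {set E}) : bool :=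
  [forall x, forall y, connect (adjS S) x y].

Definition ribbon_graph (rot : V -> seq E) : Prop :=
  [/\ (forall f, (ends f).1 != (ends f).2),
      (forall u, uniq (rot u)),
      (forall u f, (f \in rot u) = inc u f)
    & connected_via [set: E]].

Definition spanning_tree (T : {set E}) : Prop :=
  connected_via T /\
  (forall f, f \in T -> ~~ connect (adjS (T :\ f)) (ends f).1 (ends f).2).

Definition divisor := {ffun V -> int}.
Definition deg (D : divisor) : int := (\sum_u D u)%R.
Definition laplacian (h : V -> int) : divisor :=
  [ffun u => (\sum_(f | inc u f) (h u - h (other u f)))%R].
Definition principal (D : divisor) : Prop := exists h : V -> int, D = laplacian h.
Definition lin_equiv (D D' : divisor) : Prop := principal (D - D')%R.

Definition T_break (T : {set E}) (D : divisor) : Prop :=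
  exists c : E -> V, (forall f, f \notin T -> inc (c f) f) /\
    D = [ffun u => Posz #|[set f | (f \notin T) && (c f == u)]|].
Definition break_divisor (D : divisor) : Prop :=
  exists T, spanning_tree T /\ T_break T D.

(* action of Pic^0 on B(G): gamma . D is the unique break divisor linearly
   equivalent to D + gamma; here stated as the relation "D' = gamma . D". *)
Definition pic_act (gamma D D' : divisor) : Prop :=
  break_divisor D' /\ lin_equiv D' (D + gamma)%R.

Variable rot : V -> seq E.

(* a state (u, f): currently at vertex u examining edge f *)
Definition tour_step (T : {set E}) (s : V * E) : V * E :=
  let: (u, f) := s in
  if f \in T then (other u f, next (rot (other u f)) f)
  else (u, next (rot u) f).

Definition tour_states (T : {set E}) (v : V) (e : E) (k : nat) : seq (V * E) :=
  traject (tour_step T) (v, e) k.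

Definition tour_done (T : {set E}) v e (k : nat) : bool :=
  [forall f in T, (((ends f).1, f) \in tour_states T v e k)
                  && (((ends f).2, f) \in tour_states T v e k)].

(* the tour ends at the first such k (the state space is finite and the step
   map periodic, so searching k <= #|V| * #|E| suffices) *)
Definition tour_length (T : {set E}) v e : nat :=
  find (tour_done T v e) (iota 0 (#|V| * #|E|).+1).

Definition tour (T : {set E}) v e : seq (V * E) :=
  tour_states T v e (tour_length T v e).

Definition eta (T : {set E}) v e (f : E) : V :=
  (nth (v, e) (tour T v e) (find (fun s => s.2 == f) (tour T v e))).1.

Definition bernardi (v : V) (e : E) (T : {set E}) : divisor :=
  [ffun u => Posz #|[set f | (f \notin T) && (eta T v e f == u)]|].

End Ribbon.

(* Main.v *)
(* Adding an edge to a forest composes the tour step with a transposition of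
   darts, splicing two cycles into one; hence the tour of a spanning tree T is
   a single cycle through all darts, and for e in T the darts on either side of
   T - e form two contiguous arcs of it.

   Moving the start from e = vw to the next edge at v changes the Bernardi
   divisor by (w) - (v), up to the Laplacian of the indicator of the far side B
   of T - e when e is in T: the arc over B moves from the front of the tour to
   its end, so the edges between the two sides are cut first from the other end.
   This class does not depend on T, which gives (1).

   For (2), (1) makes the Bernardi divisors of T1 and T2 at e2 linearly
   equivalent. They are then equal: if D - D' is the Laplacian of a nonconstant
   h, it has degree at least the size of the cut of A = argmax h on A, more than
   the counting bounds for break divisors allow. Finally the Bernardi map is
   injective, by a degree comparison at the first dart where two tours part. *)

Require Import Defs.
From HB Require Import structures.
From mathcomp Require Import all_boot all_order all_algebra zify.
Set Implicit Arguments. Unset Strict Implicit. Unset Printing Implicit Defensive.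
Import Order.TTheory GRing.Theory Num.Theory.

(** * Endpoints of edges and connectivity within an edge set *)

Section Graph.
Variables (V E : finType) (ends : E -> V * V).
Implicit Types (S T : {set E}) (A B : {set V}) (u v w x y : V) (f e : E).

Local Notation inc := (inc ends).
Local Notation other := (other ends).
Local Notation adjS := (adjS ends).

Hypothesis loopless : forall f, (ends f).1 != (ends f).2.

Lemma inc_other u f : inc u f -> inc (other u f) f.
Proof.
by rewrite /Defs.inc /Defs.other; case: eqP => _ //; rewrite eqxx ?orbT.
Qed.

Lemma otherK u f : inc u f -> other (other u f) f = u.
Proof.
rewrite /Defs.inc /Defs.other; case: (eqVneq (ends f).1 u) => [<- _|_ /= /eqP <-].
  by rewrite (negPf (loopless f)).
by rewrite eqxx.
Qed.

Lemma other_neq u f : inc u f -> other u f != u.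
Proof.
rewrite /Defs.inc /Defs.other; case: (eqVneq (ends f).1 u) => [<- _|_ /= /eqP <-] //.
by rewrite eq_sym.
Qed.

Lemma incE u x f : inc u f -> inc x f = (x == u) || (x == other u f).
Proof.
rewrite /Defs.inc /Defs.other ![x == _]eq_sym.
by case: (eqVneq (ends f).1 u) => [<- _|_ /= /eqP <-] //; rewrite orbC.
Qed.

Lemma inc_end1 f : inc (ends f).1 f.
Proof. by rewrite /Defs.inc eqxx. Qed.

Lemma other_end1 f : other (ends f).1 f = (ends f).2.
Proof. by rewrite /Defs.other eqxx. Qed.

Lemma adjSP S x y :
  reflect (exists2 f, f \in S & inc x f /\ y = other x f) (adjS S x y).
Proof.
apply: (iffP exists_inP) => [[f fS /andP[/andP[xf yf] xy]]|[f fS [xf ->]]]; exists f => //.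
  by split=> //; move: yf xy; rewrite (incE y xf) eq_sym => /orP[->|/eqP].
by rewrite xf inc_other //= eq_sym other_neq.
Qed.

Lemma adjS_connect_sym S : connect_sym (adjS S).
Proof.
apply: sym_connect_sym => x y; rewrite /Defs.adjS; apply: eq_existsb => f.
by rewrite [inc x f && _]andbC [x == y]eq_sym.
Qed.

Lemma adjS_other S f u : f \in S -> inc u f -> adjS S u (other u f).
Proof. by move=> fS uf; apply/adjSP; exists f. Qed.

Lemma connect_adjS_sub S T x y :
  S \subset T -> connect (adjS S) x y -> connect (adjS T) x y.
Proof.
move=> ST; apply: connect_sub => {}x {}y /adjSP[f fS [xf ->]].
by apply/connect1/adjS_other => //; apply: subsetP fS.
Qed.

Lemma connect_crossing S A x y :
  connect (adjS S) x y -> x \in A -> y \notin A ->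
  exists f u, [/\ f \in S, inc u f, u \in A & other u f \notin A].
Proof.
case/connectP=> p pP ->; elim: p x pP => [|z p IHp] x /=; first by move=> _ ->.
case/andP=> /adjSP[f fS [xf ->]] pp xA; case zA: (other x f \in A); last first.
  by move=> _; exists f, x; rewrite zA.
exact: IHp pp zA.
Qed.

(** [comp] marks the components of the two endpoints of [f]: a path that uses [f] stays within their
    union. *)
Lemma connect_adjS_setU1 S f u x y : inc u f ->
  let comp z := connect (adjS S) z u || connect (adjS S) z (other u f) in
  connect (adjS (f |: S)) x y = connect (adjS S) x y || (comp x && comp y).
Proof.
move=> uf comp; have sym := adjS_connect_sym S.
have comp_connect a b : connect (adjS S) a b -> comp a = comp b.
  by move=> ab; rewrite /comp !(same_connect sym ab).
apply/idP/idP => [/connectP[p pP ->] {y}|].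
  elim: p x pP => [|z p IHp] x /=; first by rewrite connect0.
  case/andP=> /adjSP[g gS [xg ->]] /IHp {IHp}.
  move: gS; rewrite in_setU1 => /orP[/eqP gf|gS]; last first.
    have xz : connect (adjS S) x (other x g) by apply/connect1/adjS_other.
    by rewrite (same_connect sym xz) (comp_connect _ _ xz).
  move: xg; rewrite {g}gf => xf.
  have -> : comp x.
    rewrite /comp; move: xf; rewrite (incE x uf).
    by case/orP=> /eqP->; rewrite connect0 ?orbT.
  case/orP => [xy|/andP[_ ->]]; last by rewrite orbT.
  rewrite -(comp_connect _ _ xy) andTb /comp; apply/orP; right.
  have := inc_other xf; rewrite (incE _ uf) => /orP[] /eqP->; rewrite connect0 ?orbT //.
have sub a b : connect (adjS S) a b -> connect (adjS (f |: S)) a b.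
  exact/connect_adjS_sub/subsetUr.
have sym' := adjS_connect_sym (f |: S).
have ubig : connect (adjS (f |: S)) u (other u f).
  by apply/connect1/adjS_other => //; rewrite setU11.
have cu a : comp a -> connect (adjS (f |: S)) a u.
  by case/orP=> /sub // /connect_trans; apply; rewrite sym'.
by case/orP=> [/sub//|/andP[/cu xu /cu yu]]; apply: connect_trans xu _; rewrite sym'.
Qed.

(** * Counting edges of spanning trees *)

Definition forest S :=
  forall f, f \in S -> ~~ connect (adjS (S :\ f)) (ends f).1 (ends f).2.

(** With complements it yields the other edge classes needed: [touching A :&: touching (~: A)] is
    the cut of [A], and [~: touching (~: A)] consists of the edges with both ends in [A]. *)
Definition touching A : {set E} := [set f | ((ends f).1 \in A) || ((ends f).2 \in A)].

Lemma touchingP A u f : inc u f ->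
  (f \in touching A) = (u \in A) || (other u f \in A).
Proof.
rewrite inE /Defs.inc /Defs.other.
by case: (eqVneq (ends f).1 u) => [<- _|_ /= /eqP <-] //; rewrite orbC.
Qed.

Lemma forest_sub S T : S \subset T -> forest T -> forest S.
Proof.
move=> ST forT f fS; apply: contra (forT f (subsetP ST _ fS)).
by apply/connect_adjS_sub/setSD.
Qed.

Lemma forest_connectF S f u : forest S -> f \in S -> inc u f ->
  connect (adjS (S :\ f)) u (other u f) = false.
Proof.
move=> forS fS; rewrite (incE _ (inc_end1 f)) other_end1 => /orP[] /eqP->.
  by rewrite other_end1; apply/negbTE/forS.
rewrite adjS_connect_sym -{1}[in X in other X]other_end1 otherK ?inc_end1 //.
exact/negbTE/forS.
Qed.

(** Induction on [#|A|]: some edge of [T] leaves [A] at a vertex [u]; it touches [A] but not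
    [A :\ u], so removing [u] loses at least one edge. *)
Lemma card_touching_ge T A : connected_via ends T -> A != setT ->
  #|A| <= #|T :&: touching A|.
Proof.
move=> Tconn; move An: #|A| => n; elim: n A An => // n IHn A An AT.
have /card_gt0P[a aA] : 0 < #|A| by rewrite An.
have /set0Pn[b] : ~: A != set0 by rewrite -setCT (inj_eq (@setC_inj _)).
rewrite inE => bA.
have ab : connect (adjS T) a b by move/forallP/(_ a)/forallP: Tconn.
have [f [u [fT uf uA oA]]] := connect_crossing ab aA bA.
have An' : #|A :\ u| = n by move: An; rewrite (cardsD1 u) uA; lia.
have uS : A :\ u != setT.
  by apply/eqP=> /setP/(_ u); rewrite !inE eqxx.
apply: leq_ltn_trans (IHn _ An' uS) (proper_card _); apply/properP; split.
  apply/subsetP => g; rewrite !inE => /andP[-> /=].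
  by case/orP=> /andP[_ ->]; rewrite ?orbT.
exists f; rewrite in_setI fT (touchingP _ uf) ?uA // !inE eqxx /=.
by rewrite (negPf oA) andbF.
Qed.

(** A connected set of vertices is grown by one vertex and one edge of [T] at a time. Once it
    contains every vertex, a further edge of [T] would have its ends joined by the edges already
    used, against acyclicity. *)
Lemma card_spanning_tree T v : spanning_tree ends T -> #|T| < #|V|.
Proof.
case=> Tconn Tfor.
have cv x y : connect (adjS T) x y by move/forallP/(_ x)/forallP: Tconn.
have grow n : n < #|V| -> exists A S, [/\ S \subset T, #|S| <= n, #|A| = n.+1
    & {in A &, forall x y, connect (adjS S) x y}].
  elim: n => [_|n IHn nV].
    exists [set v], set0; rewrite sub0set cards0 cards1; split=> //.
    by move=> x y /set1P-> /set1P->; rewrite connect0.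
  have [A [S [ST Sn An AS]]] := IHn (ltnW nV).
  have /card_gt0P[a aA] : 0 < #|A| by rewrite An.
  have /card_gt0P[b] : 0 < #|~: A| by have := cardsC A; lia.
  rewrite inE => bA.
  have [f [u [fT uf uA oA]]] := connect_crossing (cv a b) aA bA.
  exists (other u f |: A), (f |: S); split.
  - by rewrite subUset sub1set fT.
  - by rewrite cardsU1; case: (f \notin S); lia.
  - by rewrite cardsU1 oA An.
  suff Au x : x \in other u f |: A -> connect (adjS (f |: S)) x u.
    move=> x y /Au xu /Au yu; apply: connect_trans xu _.
    by rewrite adjS_connect_sym.
  rewrite (connect_adjS_setU1 _ _ _ uf) connect0 /= andbT.
  by case/setU1P=> [->|xA]; rewrite ?connect0 ?orbT // AS.
have V0 : 0 < #|V| by apply/card_gt0P; exists v.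
have [|A [S [ST Sn An AS]]] := grow #|V|.-1; first by rewrite prednK.
have AT : A = setT.
  by apply/eqP; rewrite eqEcard subsetT cardsT An prednK /=.
suff TS : T \subset S by have := subset_leq_card TS; lia.
apply/subsetP=> f fT; apply: contraLR (Tfor f fT) => fS; rewrite negbK.
apply: connect_adjS_sub (AS _ _ _ _); rewrite ?AT ?inE //.
by rewrite subsetD1 ST.
Qed.

(** Of the fewer than [#|V|] edges of [T], at least [#|~: A|] touch the complement of [A]. *)
Lemma card_inside_spanning_tree T A : spanning_tree ends T -> A != set0 ->
  #|T :\: touching (~: A)| < #|A|.
Proof.
move=> tT A0; have [v _] := set0Pn _ A0; have := card_spanning_tree v tT.
have AT : ~: A != setT by rewrite -setC0 (inj_eq (@setC_inj _)).
have := card_touching_ge tT.1 AT; have := cardsID (touching (~: A)) T.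
by have := cardsC A; lia.
Qed.

(** * Break divisors *)

Lemma sum_chip_count T (c : E -> V) A :
  (\sum_(u in A) Posz #|[set f | (f \notin T) && (c f == u)]|)%R
  = Posz #|[set f | (f \notin T) && (c f \in A)]|.
Proof.
rewrite -(big_morph Posz PoszD (erefl _)); congr Posz.
rewrite -sum1_card (partition_big c (mem A)) /=; last first.
  by move=> f; rewrite inE => /andP[].
apply: eq_bigr => u uA; rewrite -sum1_card; apply: eq_bigl => f.
by rewrite !inE; case: eqP => [->|]; rewrite ?uA ?andbT ?andbF.
Qed.

(** An edge outside [T] must place its chip in [A] if both its ends are there, and can do so only if
    it touches [A]. The edges of [T] to subtract number fewer than [#|A|] in the first case and at
    least [#|A|] in the second. *)
Lemma break_divisor_bounds D A : break_divisor ends D -> A != set0 -> A != setT ->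
  (Posz #|~: touching (~: A)| - Posz #|A| < \sum_(u in A) D u <=
   Posz #|touching A| - Posz #|A|)%R.
Proof.
case=> T [tT [c [cE ->]]] A0 AT.
under eq_bigr do rewrite ffunE.
rewrite sum_chip_count.
have lo : #|~: touching (~: A) :\: T| <= #|[set f | (f \notin T) && (c f \in A)]|.
  apply/subset_leq_card/subsetP => f; rewrite in_setD in_setC inE => /andP[fT].
  by rewrite fT (touchingP _ (cE f fT)) inE; case: (c f \in A).
have hi : #|[set f | (f \notin T) && (c f \in A)]| <= #|touching A :\: T|.
  apply/subset_leq_card/subsetP => f; rewrite in_setD inE => /andP[fT].
  by rewrite fT (touchingP _ (cE f fT)) => ->.
have := cardsID T (~: touching (~: A)); have := cardsID T (touching A).
have := card_inside_spanning_tree tT A0; have := card_touching_ge tT.1 AT.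
rewrite setDE -[~: touching (~: A) :&: T]setIC -[touching A :&: T]setIC.
lia.
Qed.

(** At a maximum of [h] no term of the Laplacian is negative, and on an edge of the cut the term is
    at least 1 because [h] is integral. *)
Lemma sum_laplacian_max (h : V -> int) A m :
  (forall u, h u <= m)%R -> (forall u, (u \in A) = (h u == m)) ->
  (Posz #|touching A :&: touching (~: A)| <= \sum_(u in A) laplacian ends h u)%R.
Proof.
move=> hm hA; set C := _ :&: _.
pose c f := if (ends f).1 \in A then (ends f).1 else (ends f).2.
have cC f : f \in C -> [/\ inc (c f) f, c f \in A & other (c f) f \notin A].
  have uf := inc_end1 f; have := other_end1 f.
  rewrite in_setI !(touchingP _ uf) !inE /c.
  case uA: (_ \in A) => /= ow; first by move=> ->.
  by case/andP=> oA _; rewrite -ow otherK // uA oA inc_other.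
(* The cut is put in the form counted by [sum_chip_count], with [~: C] in the place of the tree. *)
have -> : C = [set f | (f \notin ~: C) && (c f \in A)].
  by apply/setP=> f; rewrite [RHS]inE in_setC negbK; case fC: (f \in C) => //; have [_ ->] := cC f fC.
rewrite -sum_chip_count; apply: ler_sum => u uA; rewrite ffunE.
have hle f : (h (other u f) <= h u)%R by move: uA; rewrite hA => /eqP->.
rewrite -sum1_card -natz natr_sum big_mkcond [leRHS]big_mkcond /=.
apply: ler_sum => f _; rewrite inE in_setC negbK.
case: (boolP (_ && _)) => [/andP[fC /eqP cu]|_]; last first.
  by case: ifP => // _; rewrite subr_ge0.
have [] := cC f fC; rewrite cu => -> _; rewrite hA.
by move: (hle f); move: uA; rewrite hA => /eqP->; lia.
Qed.

(** On [A], where [h] is maximal, the upper bound for [D] and the strict lower bound for [D'] put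
    the degree difference below the size of the cut, while the Laplacian forces at least that
    size. *)
Lemma break_divisor_unique D D' :
  break_divisor ends D -> break_divisor ends D' -> lin_equiv ends D D' -> D = D'.
Proof.
move=> bD bD' [h hD]; apply/eqP; rewrite -subr_eq0 hD.
case: (pickP (mem [set: V])) => [v0 _|noV]; last first.
  by apply/eqP/ffunP => u; have := noV u; rewrite !inE.
have [v _ vmax] := @Order.TotalTheory.arg_maxP _ _ _ v0 predT h isT.
pose A := [set u | h u == h v].
have hA u : (u \in A) = (h u == h v) by rewrite inE.
have A0 : A != set0 by apply/set0Pn; exists v; rewrite hA.
have [AT|AT] := eqVneq A setT.
  have hv u : h u = h v by apply/eqP; rewrite -hA AT inE.
  apply/eqP/ffunP => u; rewrite !ffunE big1 // => f _.
  by rewrite !hv subrr.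
have /andP[_ up] := break_divisor_bounds bD A0 AT.
have /andP[lo _] := break_divisor_bounds bD' A0 AT.
have : (Posz #|touching A :&: touching (~: A)| <=
        \sum_(u in A) D u - \sum_(u in A) D' u)%R.
  apply: le_trans (sum_laplacian_max (fun u => vmax u isT) hA) _.
  by rewrite -sumrB -hD le_eqVlt; apply/orP; left; apply/eqP/eq_bigr => u _; rewrite !ffunE.
have := cardsID (touching (~: A)) (touching A).
have : touching A :\: touching (~: A) \subset ~: touching (~: A).
  by rewrite setDE subsetIr.
move/subset_leq_card=> ? ? ?; exfalso. lia.
Qed.

End Graph.

(** * Tours *)

(** Used for splicing: if two maps agree on [s] but enter it from different points [a] and [b], the
    rest of the path is common. *)
Lemma frel_path_from (X : eqType) (g g' : X -> X) a b s z :
  path (frel g) a (rcons s z) -> g a = g' b -> {in s, g =1 g'} ->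
  path (frel g') b (rcons s z).
Proof.
elim: s a b => [|y s IHs] a b /=; first by move=> /andP[/eqP<- _] ->; rewrite eqxx.
case/andP=> /eqP ay yz abE gE; rewrite -abE ay eqxx /=.
by apply: IHs yz _ _ => [|d ds]; apply: gE; rewrite in_cons ?eqxx ?ds ?orbT.
Qed.

Lemma fcycle_cons_traject (X : eqType) (g : X -> X) a s :
  fcycle g (a :: s) -> a :: s = traject g a (size s).+1.
Proof. by rewrite /= rcons_path => /andP[/fpathE sE _]; congr cons. Qed.

Section Tours.
Variables (V E : finType) (ends : E -> V * V) (rotation : V -> seq E).
Implicit Types (S T : {set E}) (A B : {set V}) (u v w x y : V) (f e : E).
Implicit Types (d : V * E) (c s t : seq (V * E)).

Local Notation inc := (inc ends).
Local Notation other := (other ends).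
Local Notation adjS := (adjS ends).
Local Notation step := (tour_step ends rotation).

Hypothesis ribbon : ribbon_graph ends rotation.

Let loopless f : (ends f).1 != (ends f).2. Proof. by case: ribbon. Qed.
Let uniq_rotation u : uniq (rotation u). Proof. by case: ribbon. Qed.
Let mem_rotation u f : (f \in rotation u) = inc u f. Proof. by case: ribbon. Qed.

(** Pairs of a vertex and an incident edge are the darts. For a forest this is the closed tour
    around the component of [x], listed from some starting dart. *)
Definition tour_cycle S x c :=
  [/\ uniq c, fcycle (step S) c
    & forall d, (d \in c) = inc d.1 d.2 && connect (adjS S) x d.1].

Lemma tour_cycle_rot S x c n : tour_cycle S x c -> tour_cycle S x (rot n c).
Proof.
by case=> uc cc cE; split=> [||d]; rewrite ?rot_uniq ?rot_cycle ?mem_rot.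
Qed.

Lemma tour_cycle_head S x c d : tour_cycle S x c -> d \in c ->
  exists s, tour_cycle S x (d :: s).
Proof.
by move=> cS dc; have [i s dE] := rot_to dc; exists s; rewrite -dE; apply: tour_cycle_rot.
Qed.

Lemma tour_cycle_last S x c d : tour_cycle S x c -> d \in c ->
  exists s, tour_cycle S x (rcons s d).
Proof.
move=> cS /(tour_cycle_head cS)[s sS]; exists s.
by rewrite -cats1 -(rot_size_cat [:: d] s); apply: tour_cycle_rot.
Qed.

Lemma tour_cycle_connect S x y c : connect (adjS S) x y ->
  tour_cycle S x c -> tour_cycle S y c.
Proof.
move=> xy [uc cc cE]; split=> // d.
by rewrite cE (same_connect (adjS_connect_sym _ S) xy).
Qed.

Lemma tour_cycle_unique S x d s s' :
  tour_cycle S x (d :: s) -> tour_cycle S x (d :: s') -> s = s'.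
Proof.
case=> us /fcycle_cons_traject sE sm [us' /fcycle_cons_traject sE' sm'].
have: perm_eq (d :: s) (d :: s') by apply: uniq_perm => // z; rewrite sm sm'.
by move=> /perm_size [ss']; move: sE; rewrite ss' -sE' => -[].
Qed.

Lemma tour_cycle0 x : tour_cycle set0 x [seq (x, f) | f <- rotation x].
Proof.
split=> [||[y f]].
- by rewrite map_inj_uniq // => f g [].
- rewrite cycle_map; apply: sub_cycle (cycle_next (uniq_rotation x)).
  by move=> f g /eqP<- /=; rewrite inE.
- have -> : connect (adjS set0) x y = (x == y).
    apply/idP/eqP=> [/connectP[[|z p] //= /andP[]]|->]; last exact: connect0.
    by case/(adjSP loopless)=> g; rewrite inE.
  apply/mapP/andP=> /= [[g gx [-> ->]]|[yf /eqP->]].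
    by rewrite -mem_rotation.
  by exists f; rewrite ?mem_rotation.
Qed.

(** The other dart of [f] lies in a different component, and [(u, f)] itself occurs just once. *)
Lemma tour_cycle_last_edge S f u s : inc u f -> ~~ connect (adjS S) u (other u f) ->
  tour_cycle S u (rcons s (u, f)) -> forall d, d \in s -> d.2 != f.
Proof.
move=> uf uw [us _ sE] [y g] ys; apply/eqP=> /= gf; rewrite {g}gf in ys.
have := sE (y, f); rewrite mem_rcons in_cons ys orbT => /esym/andP[/= yf uy].
move: yf ys uy; rewrite (incE _ uf) => /orP[] /eqP->; last by rewrite (negPf uw).
by move: us; rewrite rcons_uniq => /andP[/negPf->].
Qed.

(* Adding the edge [f] to [S] composes the step map with the transposition of
   the two darts of [f], which splices the two cycles through these darts. *)
Lemma tour_cycle_splice S f u cu cw (w := other u f) :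
  f \notin S -> inc u f -> ~~ connect (adjS S) u w ->
  tour_cycle S u cu -> tour_cycle S w cw ->
  exists s t, [/\ tour_cycle S u (rcons s (u, f)), tour_cycle S w (rcons t (w, f))
    & tour_cycle (f |: S) u (rcons s (u, f) ++ rcons t (w, f))].
Proof.
move=> fS uf uw cuS cwS.
have wf : inc w f by apply: inc_other.
have sym := adjS_connect_sym ends S.
have [|s sS] := @tour_cycle_last S u cu (u, f) cuS.
  by case: cuS => _ _ ->; rewrite uf /=.
have [|t tS] := @tour_cycle_last S w cw (w, f) cwS.
  by case: cwS => _ _ ->; rewrite wf /=.
exists s, t; split=> //.
have [us cs sE] := sS; have [ut ct tE] := tS.
have stepE d : d.2 != f -> step S d = step (f |: S) d.
  by case: d => y g /= gf; rewrite in_setU1 (negPf gf).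
have in_s := tour_cycle_last_edge uf uw sS.
have in_t d : d \in t -> d.2 != f.
  by apply: (tour_cycle_last_edge wf) tS _; rewrite otherK // sym.
split.
- rewrite cat_uniq us ut andbT; apply/hasPn => d; rewrite sE tE => /andP[-> wd] /=.
  by apply: contra uw => /connect_trans; apply; rewrite sym.
- rewrite (cycle_path (u, f)) last_cat !last_rcons cat_path last_rcons.
  move: cs ct; rewrite !(cycle_path (u, f)) !last_rcons => cs ct.
  (* With [f] added, the step from [(w, f)] lands where the step of [S] from [(u, f)] did, and vice
     versa; so each old cycle is now entered from the last dart of the other. *)
  apply/andP; split.
    apply: frel_path_from cs _ (fun d ds => stepE d (in_s d ds)).
    by rewrite /= (negPf fS) setU11 otherK.
  apply: frel_path_from ct _ (fun d dt => stepE d (in_t d dt)).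
  by rewrite /= (negPf fS) setU11.
- move=> d; rewrite mem_cat sE tE -andb_orr (connect_adjS_setU1 loopless _ _ _ uf) connect0 /=.
  by rewrite ![connect _ d.1 _]sym orbA orbb.
Qed.

(** Induction on the number of edges. If [x] is in neither of the components joined by [f], its
    cycle contains no dart of [f] and survives unchanged. *)
Lemma tour_cycle_exists S x : forest ends S -> exists c, tour_cycle S x c.
Proof.
move Sn: #|S| => n; elim: n S Sn x => [|n IHn] S Sn x forS.
  by move/cards0_eq: Sn => ->; exists [seq (x, f) | f <- rotation x]; apply: tour_cycle0.
have /card_gt0P[f fS] : 0 < #|S| by rewrite Sn.
have S'n : #|S :\ f| = n by move: Sn; rewrite (cardsD1 f) fS; lia.
have ex y : exists c, tour_cycle (S :\ f) y c.
  have forS' : forest ends (S :\ f) := forest_sub loopless (subD1set _ _) forS.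
  exact: IHn _ S'n y forS'.
pose u := (ends f).1; have uf : inc u f by apply: inc_end1.
have [cu cuS] := ex u; have [cw cwS] := ex (other u f); have [cx cxS] := ex x.
have fS' : f \notin S :\ f by rewrite setD11.
have uw := negbT (forest_connectF loopless forS fS uf).
have [s [t [_ _ stS]]] := tour_cycle_splice fS' uf uw cuS cwS.
have sym := adjS_connect_sym ends (S :\ f).
rewrite setD1K // in stS.
have [xf|/norP[xu xw]] := boolP (connect (adjS (S :\ f)) x u ||
  connect (adjS (S :\ f)) x (other u f)).
  exists (rcons s (u, f) ++ rcons t (other u f, f)); apply: tour_cycle_connect stS.
  rewrite -(setD1K fS) (connect_adjS_setU1 loopless _ _ _ uf) connect0 /= xf.
  by rewrite orbT.
exists cx; have [ux cycx xE] := cxS; split=> // [|d]; last first.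
  by rewrite xE -{2}(setD1K fS) (connect_adjS_setU1 loopless _ _ _ uf) (negPf xu) (negPf xw) /= orbF.
have cxP : all (mem cx) cx by apply/allP.
apply: sub_in_cycle _ cxP cycx => -[y g] d' dx _ /eqP<-.
move: dx; rewrite inE xE /= in_setD1 => /andP[yg xy].
suff -> : g != f by rewrite eqxx.
apply/eqP=> gf; rewrite {g}gf in yg.
by move: yg xy; rewrite (incE _ uf) => /orP[] /eqP->; rewrite ?(negPf xu) ?(negPf xw).
Qed.

(** The splicing applied to [T :\ f]: the two arcs each end at their own dart of [f]. *)
Lemma tour_cycle_split T f u (w := other u f) :
  spanning_tree ends T -> f \in T -> inc u f ->
  exists s t, [/\ tour_cycle (T :\ f) u (rcons s (u, f)),
    tour_cycle (T :\ f) w (rcons t (w, f))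
    & tour_cycle T u (rcons s (u, f) ++ rcons t (w, f))].
Proof.
move=> [_ forT] fT uf.
have forT' : forest ends (T :\ f) by exact: (forest_sub loopless (subD1set _ _) forT).
have [cu cuT] := tour_cycle_exists u forT'.
have [cw cwT] := tour_cycle_exists w forT'.
rewrite -{3}(setD1K fT); apply: tour_cycle_splice cuT cwT => //.
  by rewrite setD11.
exact/negbT/forest_connectF.
Qed.

Lemma tour_cycle_spanning T x c : spanning_tree ends T -> tour_cycle T x c ->
  forall d, (d \in c) = inc d.1 d.2.
Proof.
case=> /forallP Tconn _ [_ _ cE] d; rewrite cE.
by have /forallP -> := Tconn x; rewrite andbT.
Qed.

Lemma tour_cycle_start T v e : spanning_tree ends T -> inc v e ->
  exists c, tour_cycle T v ((v, e) :: c).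
Proof.
move=> tT ve; have [c cT] := tour_cycle_exists v tT.2.
by apply: (tour_cycle_head cT); rewrite (tour_cycle_spanning tT cT).
Qed.

(** This is [eta] read off an arbitrary list of darts, so that it can be followed through
    concatenations; [d0] is only a default value. *)
Definition first_end d0 c f : V := (nth d0 c (find (fun d => d.2 == f) c)).1.

Local Notation examines c f := (has (fun d => d.2 == f) c).

Lemma first_end_mem d0 c f : examines c f -> (first_end d0 c f, f) \in c.
Proof.
move=> hc; have /eqP {2}<- := nth_find d0 hc.
by rewrite -surjective_pairing mem_nth // -has_find.
Qed.

Lemma first_end_cat d0 c c' f :
  first_end d0 (c ++ c') f = if examines c f then first_end d0 c f else first_end d0 c' f.
Proof.
rewrite /first_end find_cat nth_cat; case hc: (examines c f).
  by rewrite -has_find hc.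
by rewrite ltnNge leq_addr addKn.
Qed.

Lemma first_end_default d0 d1 c f : examines c f -> first_end d0 c f = first_end d1 c f.
Proof. by move=> hc; rewrite /first_end (set_nth_default d1) // -has_find. Qed.

(** For the stretch of the cycle left over when the tour stops: the step changes vertex only along
    tree edges, so a stretch without them that closes up at [(v, e)] stays at [v]. *)
Lemma tour_no_tree_suffix T v e d s :
  path (frel (step T)) d (rcons s (v, e)) -> {in d :: s, forall z, z.2 \notin T} ->
  {in d :: s, forall z, z.1 = v}.
Proof.
have stepE z : z.2 \notin T -> (step T z).1 = z.1 by case: z => y g /= /negPf->.
elim: s d => [|z s IHs] d /= /andP[/eqP dz].
  by move=> _ /(_ _ (mem_head _ _))/stepE; rewrite dz => dv z; rewrite inE => /eqP->.
move=> zs nT; have zsv : {in z :: s, forall z', z'.1 = v}.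
  by apply: IHs zs _ => z' z's; apply: nT; rewrite in_cons z's orbT.
move=> z'; rewrite in_cons => /orP[/eqP->|]; last exact: zsv.
by rewrite -stepE ?nT ?mem_head // dz zsv ?mem_head.
Qed.

(** The darts after the end of the tour all sit at [v], since no tree edge is left among them. As
    [f] has an end other than [v], the dart there was met before. *)
Lemma tour_prefix T v e c f : spanning_tree ends T -> tour_cycle T v ((v, e) :: c) ->
  f \notin T -> exists2 k, tour ends rotation T v e = take k ((v, e) :: c)
    & examines (take k ((v, e) :: c)) f.
Proof.
move=> tT cT fT; have [uc cc _] := cT; have cE := tour_cycle_spanning tT cT.
have cTr := fcycle_cons_traject cc; set n := (size c).+1 in cTr.
set full := (v, e) :: c in uc cc cE cTr *.
set k := tour_length ends rotation T v e.
have doneE j : j <= n -> tour_states ends rotation T v e j = take j full.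
  by move=> jn; rewrite cTr take_traject.
have done_n : tour_done ends rotation T v e n.
  apply/forall_inP=> g _; rewrite doneE // take_oversize // !cE /=.
  by rewrite /Defs.inc !eqxx orbT.
(* The cycle repeats no dart, so its length is within the range searched by [tour_length]. *)
have n_lt : n < (#|V| * #|E|).+1.
  by rewrite ltnS -card_prod -[n]/(size full) -(card_uniqP uc) max_card.
have has_done : has (tour_done ends rotation T v e) (iota 0 (#|V| * #|E|).+1).
  by apply/hasP; exists n; rewrite // mem_iota.
have kn : k <= n.
  rewrite leqNgt; apply/negP=> /(before_find 0).
  by rewrite nth_iota // add0n done_n.
have done_k : tour_done ends rotation T v e k.
  have := nth_find 0 has_done; rewrite nth_iota ?add0n //.
  by move: has_done; rewrite has_find size_iota.
exists k; first by rewrite /tour doneE.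
have drop_nT : {in drop k full, forall z, z.2 \notin T}.
  move=> [y g] zd; apply/negP=> /= gT.
  have := forall_inP done_k g gT; rewrite doneE // => /andP[t1 t2].
  have yg : inc y g by rewrite -(cE (y, g)) (mem_drop zd).
  have : (y, g) \in take k full.
    by move: yg; rewrite /Defs.inc => /orP[]/eqP<-.
  by apply/negP; move: uc; rewrite -{1}(cat_take_drop k full) cat_uniq => /and3P[_ /hasPn/(_ _ zd)].
have drop_v : {in drop k full, forall z, z.1 = v}.
  have : sorted (frel (step T)) (rcons full (v, e)) by exact: cc.
  rewrite -{1}(cat_take_drop k full) rcons_cat => /cat_sorted2[_].
  by case: (drop k full) drop_nT => // d s nT /tour_no_tree_suffix; apply.
have [u uf uv] : exists2 u, inc u f & u != v.
  have e1 := inc_end1 ends f; case: (eqVneq (ends f).1 v) => [ev|]; last by exists (ends f).1.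
  by exists (other v f); [apply: inc_other|apply: other_neq]; rewrite -?ev.
apply/hasP; exists (u, f); rewrite //=.
have := cE (u, f); rewrite -{1}(cat_take_drop k full) mem_cat uf => /orP[//|/drop_v/= uv'].
by rewrite uv' eqxx in uv.
Qed.

(** The first dart of [f] on the whole cycle already lies in the prefix that forms the tour. *)
Lemma eta_tour_cycle T v e c d0 f : spanning_tree ends T ->
  tour_cycle T v ((v, e) :: c) -> f \notin T ->
  Defs.eta ends rotation T v e f = first_end d0 ((v, e) :: c) f.
Proof.
move=> tT cT fT; have [k tk hk] := tour_prefix tT cT fT.
rewrite -[_ :: c](cat_take_drop k) first_end_cat hk (first_end_default d0 (v, e) hk).
by rewrite /Defs.eta tk.
Qed.

Lemma inc_eta T v e f : spanning_tree ends T -> inc v e -> f \notin T ->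
  inc (Defs.eta ends rotation T v e f) f.
Proof.
move=> tT ve fT; have [c cT] := tour_cycle_start tT ve.
rewrite (eta_tour_cycle (v, e) tT cT fT).
rewrite -[inc _ _](tour_cycle_spanning tT cT (_, _)) first_end_mem //.
apply/hasP; exists ((ends f).1, f) => //=.
by rewrite (tour_cycle_spanning tT cT) inc_end1.
Qed.

Lemma bernardi_break T v e : spanning_tree ends T -> inc v e ->
  break_divisor ends (bernardi ends rotation v e T).
Proof.
move=> tT ve; exists T; split=> //; exists (Defs.eta ends rotation T v e).
by split=> // f; apply: inc_eta.
Qed.
(** * Moving the starting edge *)

Lemma tour_cycle_examines S x c f : tour_cycle S x c ->
  examines c f = (f \in touching ends [set y | connect (adjS S) x y]).
Proof.
move=> [_ _ cE]; have f1 := inc_end1 ends f; rewrite (touchingP _ f1) !inE.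
apply/hasP/orP => [[[y g] yc /= /eqP gf]|].
  move: yc; rewrite cE {g}gf /= => /andP[yf xy].
  by move: yf; rewrite (incE _ f1) => /orP[]/eqP yE; [left|right]; rewrite -yE.
case=> xf; [exists ((ends f).1, f)|exists (other (ends f).1 f, f)] => //=.
  by rewrite cE /= f1.
by rewrite cE /= inc_other.
Qed.

(** For a spanning tree containing [f], one shore of the fundamental cut of [f], the one not
    containing the endpoint [u]. *)
Definition far_side T f u : {set V} := [set y | connect (adjS (T :\ f)) (other u f) y].

Section FarSide.
Variables (T : {set E}) (f : E) (u : V).
Hypotheses (tT : spanning_tree ends T) (fT : f \in T) (uf : inc u f).

Lemma far_sideC : ~: far_side T f u = [set y | connect (adjS (T :\ f)) u y].
Proof.
have sym := adjS_connect_sym ends (T :\ f).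
have uw := forest_connectF loopless tT.2 fT uf.
apply/setP=> y; rewrite !inE.
have : connect (adjS T) u y by case: tT => /forallP/(_ u)/forallP.
rewrite -{1}(setD1K fT) (connect_adjS_setU1 loopless _ _ _ uf) connect0 /=.
rewrite ![connect _ y _]sym orbA orbb.
case uy: (connect _ u y) => /=; last by move=> ->.
by move=> _; apply/negP=> wy; move: uw; rewrite (connect_trans uy) // sym.
Qed.

Lemma near_end_far_side : u \notin far_side T f u.
Proof. by rewrite -in_setC far_sideC inE connect0. Qed.

Lemma far_end_far_side : other u f \in far_side T f u.
Proof. by rewrite inE connect0. Qed.

Lemma tree_edge_far_side g y : g \in T -> g != f -> inc y g ->
  (other y g \in far_side T f u) = (y \in far_side T f u).
Proof.
move=> gT gf yg; rewrite !inE.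
have yo : connect (adjS (T :\ f)) y (other y g).
  by apply/connect1/adjS_other; rewrite // !inE gf.
by rewrite !(adjS_connect_sym _ _ (other u f)) (same_connect (adjS_connect_sym _ _) yo).
Qed.

(** The cycle of [T :\ f] is recorded because it shows that the arc on the side of [u] begins with
    the edge after [f] at [u]. *)
Lemma tour_cycle_far_side : exists s t,
  [/\ tour_cycle T u (rcons s (u, f) ++ rcons t (other u f, f)),
      fcycle (step (T :\ f)) (rcons s (u, f)),
      forall d, d \in rcons s (u, f) -> d.1 \notin far_side T f u,
      forall d, d \in rcons t (other u f, f) -> d.1 \in far_side T f u
    & (forall g, examines (rcons s (u, f)) g = (g \in touching ends (~: far_side T f u)))
    /\ (forall g, examines (rcons t (other u f, f)) g = (g \in touching ends (far_side T f u)))].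
Proof.
have [s [t [sT tT' stT]]] := tour_cycle_split tT fT uf; exists s, t.
have [_ cs sE] := sT; have [_ _ tE] := tT'.
split=> // [d|d|].
- by rewrite sE -in_setC far_sideC inE => /andP[].
- by rewrite tE inE => /andP[].
split=> g; last exact: tour_cycle_examines tT'.
by rewrite (tour_cycle_examines _ sT) far_sideC.
Qed.

End FarSide.

Lemma spanning_tour_examines T x c f : spanning_tree ends T -> tour_cycle T x c ->
  examines c f.
Proof.
move=> tT cT; apply/hasP; exists ((ends f).1, f) => //=.
by rewrite (tour_cycle_spanning tT cT) inc_end1.
Qed.

Lemma tour_cycle_move T x y c : spanning_tree ends T -> tour_cycle T x c -> tour_cycle T y c.
Proof. by case=> /forallP/(_ x)/forallP/(_ y) xy _; apply: tour_cycle_connect. Qed.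

Lemma eta_start T v e : spanning_tree ends T -> inc v e -> e \notin T ->
  Defs.eta ends rotation T v e e = v.
Proof.
move=> tT ve eT; have [c cT] := tour_cycle_start tT ve.
by rewrite (eta_tour_cycle (v, e) tT cT eT) /first_end /= eqxx.
Qed.

Lemma first_end_skip d0 d c f : d.2 != f -> first_end d0 (d :: c) f = first_end d0 c f.
Proof. by rewrite /first_end /= => /negPf->. Qed.

(** Cutting [e] stays at [v], so the new tour is the old cycle with [(v, e)] moved from the front to
    the end. Only [e] is affected: its other dart now comes first. *)
Lemma eta_next_nontree T v e f : spanning_tree ends T -> inc v e -> e \notin T ->
  f \notin T ->
  Defs.eta ends rotation T v (next (rotation v) e) f =
  if f == e then other v e else Defs.eta ends rotation T v e f.
Proof.
move=> tT ve eT fT; have [c cT] := tour_cycle_start tT ve.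
have [uc cc _] := cT; have cE := tour_cycle_spanning tT cT.
have wc : (other v e, e) \in c.
  have := cE (other v e, e); rewrite inc_other // in_cons xpair_eqE.
  by rewrite (negPf (other_neq loopless ve)).
have [c' cE'] : exists c', c = (v, next (rotation v) e) :: c'.
  case: {cE uc cT} c cc wc => // d c' /= /andP[/eqP<- _] _.
  by exists c'; rewrite (negPf eT).
have := tour_cycle_rot 1 cT; rewrite rot1_cons {1}cE' /= => c'T.
rewrite (eta_tour_cycle (v, e) tT c'T fT) -rcons_cons -cE' -cats1 first_end_cat.
have [->|fe] := eqVneq f e.
  have ec : examines c e by apply/hasP; exists (other v e, e).
  rewrite ec; have := first_end_mem (v, e) ec => xc.
  have := cE (first_end (v, e) c e, e); rewrite in_cons xc orbT /= => /esym.
  rewrite (incE _ ve) => /orP[]/eqP // xv; move: uc; rewrite /= -{1}xv.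
  by rewrite xc.
have ce : examines c f.
  by have := spanning_tour_examines f tT cT; rewrite /= eq_sym (negPf fe).
by rewrite ce (eta_tour_cycle (v, e) tT cT fT) first_end_skip //= eq_sym.
Qed.

(** Started at [e], the cycle runs through the arc over [B] right after [(v, e)]; started at the
    next edge, it runs through that arc last. Each edge is first cut from the side visited first
    among those it touches. *)
Lemma eta_next_tree T v e f (B := far_side T e v) :
  spanning_tree ends T -> inc v e -> e \in T -> f \notin T ->
  let eta1 := Defs.eta ends rotation T v e f in
  let eta2 := Defs.eta ends rotation T v (next (rotation v) e) f in
  [/\ (eta1 \in B) = (f \in touching ends B),
      (eta2 \notin B) = (f \in touching ends (~: B))
    & ~~ ((f \in touching ends B) && (f \in touching ends (~: B))) -> eta1 = eta2].
Proof.
move=> tT ve eT fT eta1 eta2.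
have [s [t [stT cs sB tB [sX tX]]]] := tour_cycle_far_side tT eT ve.
have ef : e != f by apply: contraNneq fT => <-.
have sX' : examines (rcons s (v, e)) f = examines s f.
  by rewrite -cats1 has_cat /= (negPf ef) !orbF.
have tsT : tour_cycle T v ((v, e) :: (rcons t (other v e, e) ++ s)).
  have := tour_cycle_rot (size s) stT.
  by rewrite -cats1 -catA rot_size_cat.
have eta1E : eta1 = first_end (v, e) (rcons t (other v e, e) ++ s) f.
  by rewrite /eta1 (eta_tour_cycle (v, e) tT tsT fT) first_end_skip.
have [s' sE] : exists s', rcons s (v, e) = (v, next (rotation v) e) :: s'.
  move: cs; rewrite (cycle_path (v, e)) last_rcons;
  case: (rcons s (v, e)) (size_rcons s (v, e)) => // d s' _ /=.
  by rewrite in_setD1 eqxx => /andP[/eqP<- _]; exists s'.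
have eta2E : eta2 = first_end (v, e) (rcons s (v, e) ++ rcons t (other v e, e)) f.
  rewrite sE cat_cons; move: stT; rewrite sE cat_cons => stT.
  exact: eta_tour_cycle.
have inS d : d \in s -> d.1 \notin B by move=> ds; apply: sB; rewrite mem_rcons in_cons ds orbT.
have fe1 c' : examines c' f -> (first_end (v, e) c' f, f) \in c' by apply: first_end_mem.
have allX : examines (rcons t (other v e, e)) f || examines s f.
  by have := spanning_tour_examines f tT tsT; rewrite /= (negPf ef) has_cat.
rewrite eta1E eta2E !first_end_cat -tX -sX.
split.
- case: ifP allX => [/fe1/tB -> //|_ /= /fe1/inS/negPf->//].
- case: ifP => [/fe1/sB -> //|]; rewrite sX' => sF.
  by move: allX; rewrite sF orbF => /fe1/tB/= ->.
- have sfe : examines s f -> first_end (v, e) (rcons s (v, e)) f = first_end (v, e) s f.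
    by move=> sF; rewrite -cats1 first_end_cat sF.
  rewrite sX'; move: allX; case: (examines (rcons t _) f) => /=; first by move=> _ /negPf->.
  by move=> sF; rewrite sF sfe.
Qed.

Definition chip u : divisor V := [ffun x => ((x == u)%:R : int)%R].

Lemma bernardiE v e T x : bernardi ends rotation v e T x =
  (\sum_f ((f \notin T) && (Defs.eta ends rotation T v e f == x))%:R)%R.
Proof.
rewrite ffunE -natz -sum1_card natr_sum big_mkcond /=; apply: eq_bigr => f _.
by rewrite inE; case: (_ && _).
Qed.

Lemma laplacianE (h : V -> int) x : laplacian ends h x =
  (\sum_f (if inc x f then h x - h (other x f) else 0))%R.
Proof. by rewrite ffunE big_mkcond. Qed.

Lemma bernardi_next v e T : spanning_tree ends T -> inc v e ->
  lin_equiv ends (bernardi ends rotation v (next (rotation v) e) T)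
    (bernardi ends rotation v e T + (chip (other v e) - chip v))%R.
Proof.
move=> tT ve; set e' := next (rotation v) e; set w := other v e.
have wv : w != v by apply: other_neq.
pose n0 x f : int := ((f \notin T) && (Defs.eta ends rotation T v e f == x))%:R%R.
pose n1 x f : int := ((f \notin T) && (Defs.eta ends rotation T v e' f == x))%:R%R.
pose move_e x f : int := (if f == e then (x == w)%:R - (x == v)%:R else 0)%R.
(* The Laplacian is a sum over edges too, so it is enough to match the contributions of each single
   edge. *)
suff [h hE] : exists h : V -> int, forall x f, (n1 x f - n0 x f - move_e x f =
    if inc x f then h x - h (other x f) else 0)%R.
  exists h; apply/ffunP=> x; rewrite laplacianE -(eq_bigr _ (fun f _ => hE x f)).
  rewrite !sumrB -big_mkcond big_pred1_eq -!bernardiE.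
  by rewrite !ffunE opprD addrA.
have [eT|eT] := boolP (e \in T); last first.
  exists (fun=> 0%R) => x f; rewrite subrr if_same /n1 /n0 /move_e.
  have [->|fe] := eqVneq f e.
    by rewrite eT /= eta_start // eta_next_nontree // eqxx ![_ == x]eq_sym subrr.
  have [fT|fT] := boolP (f \in T); first by rewrite !subrr.
  by rewrite /= eta_next_nontree // (negPf fe) !subrr.
pose B := far_side T e v.
have vB : v \notin B by apply: near_end_far_side.
have wB : w \in B by apply: far_end_far_side.
(* A non-tree edge across the cut moves its chip out of [B], as this function prescribes. The tree
   edge [e] carries no chip; its Laplacian term cancels [chip w - chip v]. *)
exists (fun x => - (x \in B)%:R)%R => x f; rewrite /n1 /n0 /move_e.
have [->|fe] := eqVneq f e.
  rewrite eT /= (incE _ ve) -/w; have [->|xw] := eqVneq x w.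
    by rewrite (negPf wv) /= otherK // wB (negPf vB).
  by have [->|//] := eqVneq x v; rewrite -/w wB (negPf vB).
have [fT|fT] /= := boolP (f \in T).
  rewrite !subrr; case: ifP => // xf.
  by rewrite (tree_edge_far_side _ fT fe xf) subrr.
have [] := eta_next_tree tT ve eT fT; rewrite -/e' -/B.
have := inc_eta tT ve fT; have : inc v e' by rewrite -mem_rotation mem_next mem_rotation.
move/(inc_eta tT)/(_ fT); set eta1 := Defs.eta _ _ _ _ e f; set eta2 := Defs.eta _ _ _ _ e' f.
have p_f := inc_end1 ends f; move: (ends f).1 p_f => p pf.
have qf := inc_other pf; have pK := otherK loopless pf.
have := other_neq loopless pf.
rewrite !(touchingP _ pf) !in_setC !(incE _ pf).
move oE: (other p f) qf pK => q qf pK qp.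
(* With [p] and [q] the ends of [f], this form shows that the term vanishes unless exactly one of
   them lies in [B]. *)
have -> : ((if (x == p) || (x == q) then - (x \in B)%:R - - (other x f \in B)%:R else 0)
    = ((q \in B)%:R - (p \in B)%:R) * ((x == p)%:R - (x == q)%:R) :> int)%R.
  have [->|xp] := eqVneq x p; first by rewrite oE eq_sym (negPf qp) /= subr0 mulr1 opprK addrC.
  by have [->|xq] /= := eqVneq x q; rewrite ?pK ?subrr ?mulr0 // sub0r mulrN1 opprK opprB addrC.
rewrite subr0 !(eq_sym _ x).
clearbody eta1 eta2.
have [pB|/negPf pB] := boolP (p \in B); have [qB|/negPf qB] := boolP (q \in B).
- by move=> _ _ _ _ /(_ isT) ->; rewrite !subrr mul0r.
- case/orP=> /eqP-> /orP[]/eqP->; rewrite ?pB ?qB //= => _ _ _.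
  by rewrite sub0r mulN1r opprB.
- case/orP=> /eqP-> /orP[]/eqP->; rewrite ?pB ?qB //= => _ _ _.
  by rewrite subr0 mul1r.
- by move=> _ _ _ _ /(_ isT) ->; rewrite !subrr mul0r.
Qed.

Lemma deg_chip u : deg (chip u) = 1%R.
Proof.
rewrite /deg (bigD1 u) //= ffunE eqxx big1 ?addr0 // => x /negPf xu.
by rewrite ffunE xu.
Qed.

Lemma principalD (D D' : divisor V) :
  principal ends D -> principal ends D' -> principal ends (D + D')%R.
Proof.
move=> [h ->] [h' ->]; exists (fun u => h u + h' u)%R; apply/ffunP=> u.
by rewrite !ffunE -big_split /=; apply: eq_bigr => f _; rewrite opprD addrACA.
Qed.

Lemma principalN (D : divisor V) : principal ends D -> principal ends (- D)%R.
Proof.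
move=> [h ->]; exists (fun u => - h u)%R; apply/ffunP=> u.
by rewrite !ffunE -sumrN; apply: eq_bigr => f _; rewrite opprD.
Qed.

Lemma principal0 : principal ends (0 : divisor V)%R.
Proof. by exists (fun=> 0%R); apply/ffunP=> u; rewrite !ffunE big1 // => f _; rewrite subrr. Qed.

(** Rotating from [e1] to [e2] adds up the differences of [bernardi_next]; these involve only the
    edges passed at [v], so one [gamma] serves all trees. *)
Lemma bernardi_shift v e1 e2 : inc v e1 -> inc v e2 ->
  exists gamma : divisor V, deg gamma = 0%R /\
    forall T, spanning_tree ends T ->
      lin_equiv ends (bernardi ends rotation v e2 T)
        (bernardi ends rotation v e1 T + gamma)%R.
Proof.
move=> v1 v2; have [i s sE] : rot_to_spec (rotation v) e1.
  by apply: rot_to; rewrite mem_rotation.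
have : fcycle (next (rotation v)) (e1 :: s).
  by rewrite -sE rot_cycle cycle_next.
move/fcycle_cons_traject => sT.
have : e2 \in e1 :: s by rewrite -sE mem_rot mem_rotation.
rewrite sT => /trajectP[n _ ->] {s sE sT e2 v2}.
have inc_iter m : inc v (iter m (next (rotation v)) e1).
  by elim: m => //= m; rewrite -!mem_rotation mem_next.
elim: n => [|n [gamma [dg IH]]].
  exists 0%R; split=> [|T tT]; first by rewrite /deg big1 // => u _; rewrite ffunE.
  by rewrite /lin_equiv addr0 subrr; apply: principal0.
pose e := iter n (next (rotation v)) e1; exists (gamma + (chip (other v e) - chip v))%R; split.
  have degD D D' : deg (D + D' : divisor V)%R = (deg D + deg D')%R.
    by rewrite /deg -big_split /=; apply: eq_bigr => u _; rewrite ffunE.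
  have := degD (chip (other v e) - chip v)%R (chip v).
  by rewrite subrK !deg_chip (degD gamma) dg; lia.
move=> T tT; rewrite /lin_equiv.
have := principalD (bernardi_next tT (inc_iter n)) (IH T tT).
have sumE (a b c d g : divisor V) :
    (d - (b + c) + (b - (a + g)) = d - (a + (g + c)))%R.
  by apply/ffunP=> u; rewrite !ffunE; lia.
by rewrite sumE.
Qed.

(** * Injectivity of the Bernardi map *)

(* [(u, f)] is the first dart at which the two tours part: [T1] walks along [f]
   while [T2] cuts it. The degrees on the side of [T1 - f] beyond [f] differ,
   since that side is still unexplored and [T2] has more edges touching it than
   [T1] has inside it. *)
Lemma bernardi_neq_of_parting T1 T2 v e c1 c2 P Q1 Q2 u f :
  spanning_tree ends T1 -> spanning_tree ends T2 ->
  tour_cycle T1 v ((v, e) :: c1) -> tour_cycle T2 v ((v, e) :: c2) ->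
  (v, e) :: c1 = P ++ (u, f) :: Q1 -> (v, e) :: c2 = P ++ (u, f) :: Q2 ->
  {in P, forall d, (d.2 \in T1) = (d.2 \in T2)} -> f \in T1 -> f \notin T2 ->
  bernardi ends rotation v e T1 <> bernardi ends rotation v e T2.
Proof.
move=> t1 t2 c1T c2T c1E c2E agree f1 f2.
have uf : inc u f.
  by rewrite -[inc u f](tour_cycle_spanning t1 c1T (u, f)) c1E mem_cat mem_head orbT.
have [s [t [stT _ sB tB [sX tX]]]] := tour_cycle_far_side t1 f1 uf.
set B := far_side T1 f u in sB tB sX tX.
have uB : u \notin B by apply: near_end_far_side.
have Pf d : d \in P -> d.2 != f.
  by move/agree => df; apply: contraNneq f2 => dE; rewrite -dE -df dE.
(* Both sides are the cycle of [T1] read from just after [(u, f)]. *)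
have QP : Q1 ++ P = rcons t (other u f, f) ++ s.
  apply: (@tour_cycle_unique T1 v (u, f)).
    by have := tour_cycle_rot (size P) c1T; rewrite c1E rot_size_cat.
  apply: (tour_cycle_move (x := u)) => //.
  have := tour_cycle_rot (size s) stT.
  by rewrite -cats1 -catA rot_size_cat.
(* The arc over [B] ends with a dart of [f], and [P] contains none, so the whole arc comes before
   the return to the start. *)
have [Q Q1E] : exists Q, Q1 = rcons t (other u f, f) ++ Q.
  have tQ : size t < size Q1.
    rewrite ltnNge; apply/negP=> Qt.
    have : nth (v, e) (Q1 ++ P) (size t) = (other u f, f).
      by rewrite QP nth_cat size_rcons ltnSn nth_rcons ltnn eqxx.
    rewrite nth_cat ltnNge Qt /= => PE.
    have szP : size t - size Q1 < size P.
      have := congr1 size QP; rewrite !size_cat size_rcons; lia.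
    by have := Pf _ (mem_nth (v, e) szP); rewrite PE eqxx.
  exists (drop (size t).+1 Q1); rewrite -{1}(cat_take_drop (size t).+1 Q1); congr (_ ++ _).
  have := congr1 (take (size t).+1) QP.
  by rewrite takel_cat // take_size_cat ?size_rcons.
have PB d : d \in P -> d.1 \notin B.
  move: QP; rewrite Q1E -catA => /eqP; rewrite eqseq_cat // => /andP[_ /eqP QPs] dP.
  by apply: sB; rewrite mem_rcons in_cons -QPs mem_cat dP !orbT.
have sub_cut g : g \in T1 -> g != f -> ~~ ((g \in touching ends B) && (g \in touching ends (~: B))).
  move=> g1 gf; rewrite !(touchingP _ (inc_end1 ends g)) !in_setC.
  by rewrite (tree_edge_far_side _ g1 gf (inc_end1 ends g)); case: (_ \in _).
(* The edges touching [B] that are still unexamined when the tours part. [T1] then tours [B] at once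
   and cuts all its non-tree edges in [X] from inside; under [T2] only edges of [X] can be cut from
   [B]. *)
pose X := [set g | [&& g \in touching ends B, g != f & ~~ examines P g]].
have XE g : (g \in X) = [&& g \in touching ends B, g != f & ~~ examines P g].
  by rewrite inE.
have lo : #|X :\: T1| <=
    #|[set g | (g \notin T1) && (Defs.eta ends rotation T1 v e g \in B)]|.
  apply/subset_leq_card/subsetP => g; rewrite in_setD XE => /andP[gT1 /and3P[gB gf Pg]].
  rewrite inE gT1 /= (eta_tour_cycle (v, e) t1 c1T gT1) c1E first_end_cat (negPf Pg).
  rewrite first_end_skip 1?eq_sym // Q1E first_end_cat tX gB.
  by apply: (tB (_, g)); apply: first_end_mem; rewrite tX.
have hi : #|[set g | (g \notin T2) && (Defs.eta ends rotation T2 v e g \in B)]| <=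
    #|X :\: T2|.
  apply/subset_leq_card/subsetP => g; rewrite inE in_setD XE => /andP[gT2].
  have ve : inc v e by rewrite -[inc v e](tour_cycle_spanning t1 c1T (v, e)) mem_head.
  have := inc_eta t2 ve gT2; rewrite gT2 /= (eta_tour_cycle (v, e) t2 c2T gT2).
  rewrite c2E first_end_cat => eg etaB; rewrite (touchingP _ eg) etaB /=.
  move: etaB; case: ifP => [Pg|Pg].
    by move/(negP (PB (_, g) (first_end_mem (v, e) Pg))).
  by rewrite andbT; apply: contraTneq => ->; rewrite /first_end /= eqxx.
have B0 : B != set0 by apply/set0Pn; exists (other u f); apply: far_end_far_side.
have BT : B != setT by apply/eqP=> BT; rewrite BT inE in uB.
have in1 : #|T1 :&: X| <= #|T1 :\: touching ends (~: B)|.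
  apply/subset_leq_card/subsetP => g; rewrite in_setI in_setD XE.
  case/andP=> g1 /and3P[gB gf _]; rewrite g1 andbT.
  by have := sub_cut g g1 gf; rewrite gB.
(* A tree edge of [T2] examined in [P] is also in [T1]; it differs from [f] and was met outside [B],
   so it cannot touch [B]. *)
have in2 : #|T2 :&: touching ends B| <= #|T2 :&: X|.
  apply/subset_leq_card/subsetP => g; rewrite !in_setI XE => /andP[g2 gB].
  rewrite g2 gB /=; apply/andP; split; first by apply: contraNneq f2 => <-.
  apply/hasPn => -[y h] dP /=; apply/eqP=> hg; rewrite {h}hg in dP.
  have g1 : g \in T1 by have := agree _ dP; rewrite /= g2.
  have yg : inc y g.
    by rewrite -[inc y g](tour_cycle_spanning t1 c1T (y, g)) c1E mem_cat dP.
  have := sub_cut g g1 (Pf _ dP); rewrite gB (touchingP _ yg) in_setC.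
  by rewrite (PB _ dP).
(* [T1] has fewer than [#|B|] edges in [X] and [T2] at least [#|B|], so [T1] leaves more edges of
   [X] to be cut than [T2]. *)
have := card_inside_spanning_tree loopless t1 B0; have := card_touching_ge loopless t2.1 BT.
have := cardsID T1 X; have := cardsID T2 X; rewrite -![X :&: _]setIC => X2 X1 ge2 lt1 eqB.
have : (\sum_(y in B) bernardi ends rotation v e T1 y =
        \sum_(y in B) bernardi ends rotation v e T2 y)%R.
  by rewrite eqB.
rewrite (eq_bigr _ (fun y _ => ffunE _ y)) [RHS](eq_bigr _ (fun y _ => ffunE _ y)).
rewrite !sum_chip_count; lia.
Qed.

(** A step depends on the tree only through membership of the examined edge, so the two cycles
    coincide up to and including the first dart whose edge lies in exactly one tree. *)
Lemma bernardi_inj v e T1 T2 : spanning_tree ends T1 -> spanning_tree ends T2 ->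
  inc v e -> bernardi ends rotation v e T1 = bernardi ends rotation v e T2 -> T1 = T2.
Proof.
move=> t1 t2 ve eqB; apply/eqP; apply: contraPT eqB => neqT.
have [c1 c1T] := tour_cycle_start t1 ve; have [c2 c2T] := tour_cycle_start t2 ve.
pose differ d := (d.2 \in T1) != (d.2 \in T2) : bool.
have hd : has differ ((v, e) :: c1).
  have [f fd] : exists f, (f \in T1) != (f \in T2).
    apply/existsP; apply: contraNT neqT; rewrite negb_exists => /forallP eqT.
    by apply/eqP/setP => f; have := eqT f; rewrite negbK => /eqP.
  apply/hasP; exists ((ends f).1, f) => //.
  by rewrite (tour_cycle_spanning t1 c1T) inc_end1.
have sz : size c2 = size c1.
  have [uc1 _ _] := c1T; have [uc2 _ _] := c2T.
  have : perm_eq ((v, e) :: c2) ((v, e) :: c1).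
    by apply: uniq_perm => // d; rewrite (tour_cycle_spanning t1 c1T) (tour_cycle_spanning t2 c2T).
  by move/perm_size => [].
have [_ /fcycle_cons_traject c1E _] := c1T; have [_ /fcycle_cons_traject c2E _] := c2T.
set n := (size c1).+1 in c1E; rewrite sz -/n in c2E.
set k := find differ ((v, e) :: c1).
have kn : k < n by rewrite has_find in hd.
have agree_nth j : j < k -> differ (nth (v, e) ((v, e) :: c1) j) = false by apply: before_find.
have same j : j <= k -> iter j (step T1) (v, e) = iter j (step T2) (v, e).
  elim: j => // j IHj jk; rewrite !iterS -(IHj (ltnW jk)).
  have := agree_nth j jk; rewrite c1E nth_traject ?(ltn_trans jk) //.
  by case: (iter _ _ _) => y g /= /eqP ->.
have take_same : take k ((v, e) :: c2) = take k ((v, e) :: c1).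
  apply: (@eq_from_nth _ (v, e)); first by rewrite !size_take /= sz.
  move=> j; rewrite size_take /= sz -/n kn => jk.
  by rewrite !nth_take // c1E c2E !nth_traject ?(ltn_trans jk) // same // ltnW.
have split_at c : size c = n -> c = take k c ++ nth (v, e) c k :: drop k.+1 c.
  by move=> cn; rewrite -drop_nth ?cn // cat_take_drop.
have s1 : size ((v, e) :: c1) = n by [].
have s2 : size ((v, e) :: c2) = n by rewrite /= sz.
have nth2 : nth (v, e) ((v, e) :: c2) k = nth (v, e) ((v, e) :: c1) k.
  by rewrite c1E c2E !nth_traject // same.
have E1 := split_at _ s1; have E2 := split_at _ s2.
rewrite nth2 take_same in E2.
have agree : {in take k ((v, e) :: c1), forall d, (d.2 \in T1) = (d.2 \in T2)}.
  move=> d /(nthP (v, e))[j]; rewrite size_take s1 kn => jk.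
  by rewrite nth_take // => <-; apply/eqP/negbFE/agree_nth.
have := nth_find (v, e) hd; rewrite -/k /differ.
case: (nth _ _ k) E1 E2 => u f E1 E2 /=.
case f1: (f \in T1); case f2: (f \in T2) => // _.
  by apply: bernardi_neq_of_parting c1T c2T E1 E2 agree f1 _; rewrite ?f2.
apply/nesym; apply: bernardi_neq_of_parting c2T c1T E2 E1 _ f2 _; rewrite ?f1 //.
by move=> d /agree.
Qed.

End Tours.

(** * The action on spanning trees *)

Theorem theorem4p1 (V E : finType) (ends : E -> V * V) (rot : V -> seq E)
  (v : V) :
  ribbon_graph ends rot ->
  (* (1) *)
  (forall e1 e2 : E, inc ends v e1 -> inc ends v e2 ->
     exists gamma0 : divisor V, deg gamma0 = 0%R /\
       forall T : {set E}, spanning_tree ends T ->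
         pic_act ends gamma0 (bernardi ends rot v e1 T)
                             (bernardi ends rot v e2 T))
  /\
  (* (2) *)
  (forall e1 e2 : E, inc ends v e1 -> inc ends v e2 ->
     forall gamma : divisor V, deg gamma = 0%R ->
     forall T T1 T2 : {set E},
       spanning_tree ends T -> spanning_tree ends T1 -> spanning_tree ends T2 ->
       pic_act ends gamma (bernardi ends rot v e1 T) (bernardi ends rot v e1 T1) ->
       pic_act ends gamma (bernardi ends rot v e2 T) (bernardi ends rot v e2 T2) ->
       T1 = T2).
Proof.
move=> ribbon; have loopless f : (ends f).1 != (ends f).2 by case: ribbon.
split=> [e1 e2 v1 v2|e1 e2 v1 v2 gamma _ T T1 T2 tT t1 t2 [_ act1] [_ act2]].
  have [gamma0 [deg0 shift]] := bernardi_shift ribbon v1 v2; exists gamma0.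
  by split=> // T tT; split; [apply: bernardi_break|apply: shift].
have [gamma0 [_ shift]] := bernardi_shift ribbon v1 v2.
apply: (bernardi_inj ribbon t1 t2 v2).
apply: (break_divisor_unique loopless); try exact: bernardi_break.
have sT := shift T tT; have s1 := shift T1 t1.
(* At [e2] the divisors of [T1] and [T2] are both equivalent to the divisor of [T] at [e1] plus
   [gamma0 + gamma]: shifting by [gamma0] commutes with adding [gamma]. *)
have := principalD (principalD s1 act1) (principalN (principalD act2 sT)).
rewrite /lin_equiv; congr principal.
by apply/ffunP=> u; rewrite !ffunE; lia.
Qed.
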